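(* (d'Ocagne identity for $\mathbf{Q}W_n(s)$.) Let $n\geq 0$, $m\geq 0$ be integers such that $n\geq m$. Then $$\mathbf{Q}W_{m+1}(s)\,\mathbf{Q}W_{n}(s)-\mathbf{Q}W_{m}(s)\,\mathbf{Q}W_{n+1}(s)=\frac{AB(\alpha\beta)^{sm}\left(\alpha^{s}-\beta^{s}\right)}{\left[A\alpha^{s}-B\beta^{s}\right]^{2}}\Big\{\left(\alpha^{s(n-m)}-\beta^{s(n-m)}\right)\Theta_{\alpha}(s)\Theta_{\beta}(s)+\alpha^{s(n-m)}\left[\Theta_{\beta}(s),\Theta_{\alpha}(s)\right]\Big\},$$ where $\left[\Theta_{\beta}(s),\Theta_{\alpha}(s)\right]=2(\alpha\beta)^{s}(\alpha^{s}-\beta^{s})\left[\lambda_{3}(\alpha\beta)^{s}\mathbf{i}-\lambda_{2}(\alpha^{s}+\beta^{s})\mathbf{j}+\lambda_{1}\mathbf{k}\right]$.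
   Context: Let $\alpha,\beta$ be distinct nonzero real numbers, $W_0,W_1$ real numbers, $A=W_1-W_0\beta$, $B=W_1-W_0\alpha$, and let $W_n=\frac{A\alpha^n-B\beta^n}{\alpha-\beta}$ ($n\geq 0$) be the Horadam numbers. Fix an integer $s\geq 1$ with $W_s\neq 0$, equivalently $A\alpha^s-B\beta^s\neq 0$. The higher order Horadam numbers are $W_n(s)=\frac{W_{sn}}{W_s}=\frac{A\alpha^{sn}-B\beta^{sn}}{A\alpha^s-B\beta^s}$, $n\geq 0$. Let $\lambda_1,\lambda_2,\lambda_3$ be real parameters. The 3-parameter generalized quaternions form the real algebra of elements $x_0\mathbf{1}+x_1\mathbf{i}+x_2\mathbf{j}+x_3\mathbf{k}$ ($x_r\in\mathbb{R}$) with basis $\mathbf{1},\mathbf{i},\mathbf{j},\mathbf{k}$ and bilinear multiplication in which $\mathbf{1}$ is the identity and $\mathbf{i}^2=-\lambda_1\lambda_2\mathbf{1}$, $\mathbf{j}^2=-\lambda_1\lambda_3\mathbf{1}$, $\mathbf{k}^2=-\lambda_2\lambda_3\mathbf{1}$, $\mathbf{i}\mathbf{j}=\lambda_1\mathbf{k}=-\mathbf{j}\mathbf{i}$, $\mathbf{j}\mathbf{k}=\lambda_3\mathbf{i}=-\mathbf{k}\mathbf{j}$, $\mathbf{k}\mathbf{i}=\lambda_2\mathbf{j}=-\mathbf{i}\mathbf{k}$. The higher order Horadam 3-parameter generalized quaternions are $\mathbf{Q}W_n(s)=W_n(s)\mathbf{1}+W_{n+1}(s)\mathbf{i}+W_{n+2}(s)\mathbf{j}+W_{n+3}(s)\mathbf{k}$,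 $n\geq 0$. Put $\Theta_{\alpha}(s)=\mathbf{1}+\alpha^{s}\mathbf{i}+\alpha^{2s}\mathbf{j}+\alpha^{3s}\mathbf{k}$ and $\Theta_{\beta}(s)=\mathbf{1}+\beta^{s}\mathbf{i}+\beta^{2s}\mathbf{j}+\beta^{3s}\mathbf{k}$; the bracket $[\Theta_\beta(s),\Theta_\alpha(s)]$ denotes the commutator $\Theta_\beta(s)\Theta_\alpha(s)-\Theta_\alpha(s)\Theta_\beta(s)$. *)

(* Defs.v *)
From HB Require Import structures.
From mathcomp Require Import all_boot all_order all_algebra.
From mathcomp Require Import reals.
From mathcomp Require Import ring.

Set Implicit Arguments.
Unset Strict Implicit.
Unset Printing Implicit Defensive.

Import GRing.Theory.
Local Open Scope ring_scope.

(* The parameters l1 l2 l3 do not occur in the fields: they index the type, so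
   that each choice of parameters carries its own multiplication. *)
Record gquat (R : realType) (l1 l2 l3 : R) :=
  GQuat { qre : R; qim_i : R; qim_j : R; qim_k : R }.

Definition gquat_tuple (R : realType) (l1 l2 l3 : R) (x : gquat l1 l2 l3) :
  R * R * R * R := (qre x, qim_i x, qim_j x, qim_k x).

Definition tuple_gquat (R : realType) (l1 l2 l3 : R) (t : R * R * R * R) :
  gquat l1 l2 l3 := GQuat l1 l2 l3 t.1.1.1 t.1.1.2 t.1.2 t.2.

Lemma gquat_tupleK (R : realType) (l1 l2 l3 : R) :
  cancel (@gquat_tuple R l1 l2 l3) (@tuple_gquat R l1 l2 l3).
Proof. by case. Qed.

HB.instance Definition _ (R : realType) (l1 l2 l3 : R) :=
  Choice.copy (gquat l1 l2 l3) (can_type (@gquat_tupleK R l1 l2 l3)).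

Lemma gquatP (R : realType) (l1 l2 l3 : R) (x y : gquat l1 l2 l3) :
  qre x = qre y -> qim_i x = qim_i y -> qim_j x = qim_j y ->
  qim_k x = qim_k y -> x = y.
Proof. by case: x y => [? ? ? ?] [? ? ? ?] /= -> -> -> ->. Qed.

Definition gquat_zero (R : realType) (l1 l2 l3 : R) : gquat l1 l2 l3 :=
  GQuat l1 l2 l3 0 0 0 0.

Definition gquat_opp (R : realType) (l1 l2 l3 : R) (x : gquat l1 l2 l3) :=
  GQuat l1 l2 l3 (- qre x) (- qim_i x) (- qim_j x) (- qim_k x).

Definition gquat_add (R : realType) (l1 l2 l3 : R) (x y : gquat l1 l2 l3) :=
  GQuat l1 l2 l3 (qre x + qre y) (qim_i x + qim_i y) (qim_j x + qim_j y)
    (qim_k x + qim_k y).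

Fact gquat_addA (R : realType) (l1 l2 l3 : R) :
  associative (@gquat_add R l1 l2 l3).
Proof. by move=> x y z; apply: gquatP => /=; rewrite addrA. Qed.

Fact gquat_addC (R : realType) (l1 l2 l3 : R) :
  commutative (@gquat_add R l1 l2 l3).
Proof. by move=> x y; apply: gquatP => /=; rewrite addrC. Qed.

Fact gquat_add0 (R : realType) (l1 l2 l3 : R) :
  left_id (@gquat_zero R l1 l2 l3) (@gquat_add R l1 l2 l3).
Proof. by move=> x; apply: gquatP => /=; rewrite add0r. Qed.

Fact gquat_addN (R : realType) (l1 l2 l3 : R) :
  left_inverse (@gquat_zero R l1 l2 l3) (@gquat_opp R l1 l2 l3)
    (@gquat_add R l1 l2 l3).
Proof. by move=> x; apply: gquatP => /=; rewrite addNr. Qed.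

HB.instance Definition _ (R : realType) (l1 l2 l3 : R) :=
  GRing.isZmodule.Build (gquat l1 l2 l3) (@gquat_addA R l1 l2 l3)
    (@gquat_addC R l1 l2 l3) (@gquat_add0 R l1 l2 l3) (@gquat_addN R l1 l2 l3).

Definition gquat_one (R : realType) (l1 l2 l3 : R) : gquat l1 l2 l3 :=
  GQuat l1 l2 l3 1 0 0 0.

(* Bilinear extension of the multiplication table of the basis, which is
   recovered in the lemmas gquat_ii, ..., gquat_ik below. *)
Definition gquat_mul (R : realType) (l1 l2 l3 : R) (x y : gquat l1 l2 l3) :=
  let: GQuat x0 x1 x2 x3 := x in
  let: GQuat y0 y1 y2 y3 := y in
  GQuat l1 l2 l3
    (x0 * y0 - l1 * l2 * (x1 * y1) - l1 * l3 * (x2 * y2) - l2 * l3 * (x3 * y3))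
    (x0 * y1 + x1 * y0 + l3 * (x2 * y3 - x3 * y2))
    (x0 * y2 + x2 * y0 + l2 * (x3 * y1 - x1 * y3))
    (x0 * y3 + x3 * y0 + l1 * (x1 * y2 - x2 * y1)).

Fact gquat_mulA (R : realType) (l1 l2 l3 : R) :
  associative (@gquat_mul R l1 l2 l3).
Proof. by move=> [? ? ? ?] [? ? ? ?] [? ? ? ?]; apply: gquatP => /=; ring. Qed.

Fact gquat_mul1l (R : realType) (l1 l2 l3 : R) :
  left_id (@gquat_one R l1 l2 l3) (@gquat_mul R l1 l2 l3).
Proof. by move=> [? ? ? ?]; apply: gquatP => /=; ring. Qed.

Fact gquat_mul1r (R : realType) (l1 l2 l3 : R) :
  right_id (@gquat_one R l1 l2 l3) (@gquat_mul R l1 l2 l3).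
Proof. by move=> [? ? ? ?]; apply: gquatP => /=; ring. Qed.

Fact gquat_mulDl (R : realType) (l1 l2 l3 : R) :
  left_distributive (@gquat_mul R l1 l2 l3) +%R.
Proof. by move=> [? ? ? ?] [? ? ? ?] [? ? ? ?]; apply: gquatP => /=; ring. Qed.

Fact gquat_mulDr (R : realType) (l1 l2 l3 : R) :
  right_distributive (@gquat_mul R l1 l2 l3) +%R.
Proof. by move=> [? ? ? ?] [? ? ? ?] [? ? ? ?]; apply: gquatP => /=; ring. Qed.

Fact gquat_one_neq0 (R : realType) (l1 l2 l3 : R) :
  gquat_one l1 l2 l3 != 0.
Proof. by apply/eqP => /(congr1 (@qre _ _ _ _)) /eqP; rewrite oner_eq0. Qed.

HB.instance Definition _ (R : realType) (l1 l2 l3 : R) :=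
  GRing.Zmodule_isNzRing.Build (gquat l1 l2 l3) (@gquat_mulA R l1 l2 l3)
    (@gquat_mul1l R l1 l2 l3) (@gquat_mul1r R l1 l2 l3)
    (@gquat_mulDl R l1 l2 l3) (@gquat_mulDr R l1 l2 l3)
    (@gquat_one_neq0 R l1 l2 l3).

Definition gquat_scale (R : realType) (l1 l2 l3 : R) (a : R)
    (x : gquat l1 l2 l3) :=
  GQuat l1 l2 l3 (a * qre x) (a * qim_i x) (a * qim_j x) (a * qim_k x).

Fact gquat_scaleA (R : realType) (l1 l2 l3 : R) (a b : R)
    (x : gquat l1 l2 l3) :
  gquat_scale a (gquat_scale b x) = gquat_scale (a * b) x.
Proof. by apply: gquatP => /=; rewrite mulrA. Qed.

Fact gquat_scale1 (R : realType) (l1 l2 l3 : R) :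
  left_id 1 (@gquat_scale R l1 l2 l3).
Proof. by move=> x; apply: gquatP => /=; rewrite mul1r. Qed.

Fact gquat_scaleDr (R : realType) (l1 l2 l3 : R) :
  right_distributive (@gquat_scale R l1 l2 l3) +%R.
Proof. by move=> a x y; apply: gquatP => /=; rewrite mulrDr. Qed.

Fact gquat_scaleDl (R : realType) (l1 l2 l3 : R) (x : gquat l1 l2 l3) :
  {morph (@gquat_scale R l1 l2 l3)^~ x : a b / a + b}.
Proof. by move=> a b; apply: gquatP => /=; rewrite mulrDl. Qed.

HB.instance Definition _ (R : realType) (l1 l2 l3 : R) :=
  GRing.Zmodule_isLmodule.Build R (gquat l1 l2 l3) (@gquat_scaleA R l1 l2 l3)
    (@gquat_scale1 R l1 l2 l3) (@gquat_scaleDr R l1 l2 l3)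
    (@gquat_scaleDl R l1 l2 l3).

Fact gquat_scaleAl (R : realType) (l1 l2 l3 : R) (a : R)
    (x y : gquat l1 l2 l3) : a *: (x * y) = (a *: x) * y.
Proof. by case: x y => [? ? ? ?] [? ? ? ?]; apply: gquatP => /=; ring. Qed.

HB.instance Definition _ (R : realType) (l1 l2 l3 : R) :=
  GRing.Lmodule_isLalgebra.Build R (gquat l1 l2 l3) (@gquat_scaleAl R l1 l2 l3).

Fact gquat_scaleAr (R : realType) (l1 l2 l3 : R) (a : R)
    (x y : gquat l1 l2 l3) : a *: (x * y) = x * (a *: y).
Proof. by case: x y => [? ? ? ?] [? ? ? ?]; apply: gquatP => /=; ring. Qed.

HB.instance Definition _ (R : realType) (l1 l2 l3 : R) :=
  GRing.Lalgebra_isAlgebra.Build R (gquat l1 l2 l3)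
    (@gquat_scaleAr R l1 l2 l3).

Definition qi (R : realType) (l1 l2 l3 : R) : gquat l1 l2 l3 :=
  GQuat l1 l2 l3 0 1 0 0.
Definition qj (R : realType) (l1 l2 l3 : R) : gquat l1 l2 l3 :=
  GQuat l1 l2 l3 0 0 1 0.
Definition qk (R : realType) (l1 l2 l3 : R) : gquat l1 l2 l3 :=
  GQuat l1 l2 l3 0 0 0 1.

Lemma gquatE (R : realType) (l1 l2 l3 : R) (x : gquat l1 l2 l3) :
  x = qre x *: 1 + qim_i x *: qi l1 l2 l3 + qim_j x *: qj l1 l2 l3
      + qim_k x *: qk l1 l2 l3.
Proof. by apply: gquatP => /=; ring. Qed.

Lemma gquat_ii (R : realType) (l1 l2 l3 : R) :
  qi l1 l2 l3 * qi l1 l2 l3 = - (l1 * l2) *: 1.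
Proof. by apply: gquatP => /=; ring. Qed.

Lemma gquat_jj (R : realType) (l1 l2 l3 : R) :
  qj l1 l2 l3 * qj l1 l2 l3 = - (l1 * l3) *: 1.
Proof. by apply: gquatP => /=; ring. Qed.

Lemma gquat_kk (R : realType) (l1 l2 l3 : R) :
  qk l1 l2 l3 * qk l1 l2 l3 = - (l2 * l3) *: 1.
Proof. by apply: gquatP => /=; ring. Qed.

Lemma gquat_ij (R : realType) (l1 l2 l3 : R) :
  qi l1 l2 l3 * qj l1 l2 l3 = l1 *: qk l1 l2 l3.
Proof. by apply: gquatP => /=; ring. Qed.

Lemma gquat_ji (R : realType) (l1 l2 l3 : R) :
  qj l1 l2 l3 * qi l1 l2 l3 = - (l1 *: qk l1 l2 l3).
Proof. by apply: gquatP => /=; ring. Qed.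

Lemma gquat_jk (R : realType) (l1 l2 l3 : R) :
  qj l1 l2 l3 * qk l1 l2 l3 = l3 *: qi l1 l2 l3.
Proof. by apply: gquatP => /=; ring. Qed.

Lemma gquat_kj (R : realType) (l1 l2 l3 : R) :
  qk l1 l2 l3 * qj l1 l2 l3 = - (l3 *: qi l1 l2 l3).
Proof. by apply: gquatP => /=; ring. Qed.

Lemma gquat_ki (R : realType) (l1 l2 l3 : R) :
  qk l1 l2 l3 * qi l1 l2 l3 = l2 *: qj l1 l2 l3.
Proof. by apply: gquatP => /=; ring. Qed.

Lemma gquat_ik (R : realType) (l1 l2 l3 : R) :
  qi l1 l2 l3 * qk l1 l2 l3 = - (l2 *: qj l1 l2 l3).
Proof. by apply: gquatP => /=; ring. Qed.

Definition commutator (S : nzRingType) (x y : S) : S := x * y - y * x.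

Definition horadamA (R : realType) (beta W0 W1 : R) : R := W1 - W0 * beta.
Definition horadamB (R : realType) (alpha W0 W1 : R) : R := W1 - W0 * alpha.

Definition horadam (R : realType) (alpha beta W0 W1 : R) (n : nat) : R :=
  (horadamA beta W0 W1 * alpha ^+ n - horadamB alpha W0 W1 * beta ^+ n)
  / (alpha - beta).

Definition ho_horadam (R : realType) (alpha beta W0 W1 : R) (s n : nat) : R :=
  horadam alpha beta W0 W1 (s * n) / horadam alpha beta W0 W1 s.

Definition QW (R : realType) (l1 l2 l3 alpha beta W0 W1 : R) (s n : nat) :
    gquat l1 l2 l3 :=
  ho_horadam alpha beta W0 W1 s n *: 1
  + ho_horadam alpha beta W0 W1 s n.+1 *: qi l1 l2 l3
  + ho_horadam alpha beta W0 W1 s n.+2 *: qj l1 l2 l3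
  + ho_horadam alpha beta W0 W1 s n.+3 *: qk l1 l2 l3.

Definition Theta (R : realType) (l1 l2 l3 x : R) (s : nat) : gquat l1 l2 l3 :=
  1 + x ^+ s *: qi l1 l2 l3 + x ^+ (2 * s) *: qj l1 l2 l3
  + x ^+ (3 * s) *: qk l1 l2 l3.

(* Main.v *)
(* With a = alpha^s, b = beta^s and D = A a - B b, the Binet form reads
   Q_n = (A a^n Theta_alpha - B b^n Theta_beta) / D.  In the d'Ocagne difference
   the squares Theta_alpha^2 and Theta_beta^2 cancel, and what is left is
   A B (a b)^m (a - b) / D^2 times
   a^(n-m) Theta_beta Theta_alpha - b^(n-m) Theta_alpha Theta_beta. *)
Require Import Defs.
From HB Require Import structures.
From mathcomp Require Import all_boot all_order all_algebra.
From mathcomp Require Import reals.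
From mathcomp Require Import ring.

Set Implicit Arguments.
Unset Strict Implicit.
Unset Printing Implicit Defensive.

Import GRing.Theory.
Local Open Scope ring_scope.

(** The common denominator [alpha - beta], nonzero by hypothesis, cancels in the quotient. *)
Lemma ho_horadamE (R : realType) (alpha beta W0 W1 : R) (s n : nat) :
  alpha <> beta ->
  ho_horadam alpha beta W0 W1 s n =
    (horadamA beta W0 W1 * (alpha ^+ s) ^+ n
     - horadamB alpha W0 W1 * (beta ^+ s) ^+ n)
    / (horadamA beta W0 W1 * alpha ^+ s - horadamB alpha W0 W1 * beta ^+ s).
Proof.
move=> /eqP neq_ab; rewrite /ho_horadam /horadam invf_div mulrA divfK //.
  by rewrite !exprM.
by rewrite subr_eq0.
Qed.

Lemma Theta_coord (R : realType) (l1 l2 l3 x : R) (s : nat) :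
  Theta l1 l2 l3 x s =
    GQuat l1 l2 l3 1 (x ^+ s) ((x ^+ s) ^+ 2) ((x ^+ s) ^+ 3).
Proof.
by rewrite /Theta ![(_ * s)%N]mulnC !exprM; apply: gquatP => /=; ring.
Qed.

(** Raising the index by 1, 2, 3 multiplies the two geometric terms by powers of [alpha ^+ s] and
    [beta ^+ s], which are the coordinates of the two [Theta]. *)
Lemma QW_Binet (R : realType) (l1 l2 l3 alpha beta W0 W1 : R) (s n : nat) :
  alpha <> beta ->
  let A := horadamA beta W0 W1 in
  let B := horadamB alpha W0 W1 in
  QW l1 l2 l3 alpha beta W0 W1 s n =
    (A * alpha ^+ s - B * beta ^+ s)^-1
    *: ((A * (alpha ^+ s) ^+ n) *: Theta l1 l2 l3 alpha s
        - (B * (beta ^+ s) ^+ n) *: Theta l1 l2 l3 beta s).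
Proof.
move=> neq_ab A B; rewrite /QW !ho_horadamE // -/A -/B !Theta_coord.
(* Peeling the shifted powers down to exponent [n] leaves the [n]-th powers as atoms for [ring]. *)
by apply: gquatP => /=; rewrite !(exprS _ n.+2, exprS _ n.+1, exprS _ n); ring.
Qed.

(** Adding and subtracting [a ^+ d *: (x * y)] turns the remainder
    [a ^+ d *: (y * x) - b ^+ d *: (x * y)] into the bracket form. Writing the larger index as
    [d + m] avoids truncated subtraction. *)
Lemma Binet_dOcagne (R : realType) (l1 l2 l3 a b c A B : R)
    (x y : gquat l1 l2 l3) (q : nat -> gquat l1 l2 l3) (m d : nat) :
  (forall n, q n = c *: ((A * a ^+ n) *: x - (B * b ^+ n) *: y)) ->
  q m.+1 * q (d + m)%N - q m * q (d + m).+1 =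
    (A * B * (a * b) ^+ m * (a - b) * c ^+ 2)
    *: ((a ^+ d - b ^+ d) *: (x * y) + a ^+ d *: commutator y x).
Proof.
case: x y => [x0 x1 x2 x3] [y0 y1 y2 y3] qE.
rewrite !qE /commutator exprMn !exprS !exprD.
by apply: gquatP => /=; ring.
Qed.

(** Real parts commute, so only twice the weighted cross product of the imaginary parts survives;
    its entries share the factor [(x * y) ^+ s * (x ^+ s - y ^+ s)]. *)
Lemma commutator_Theta (R : realType) (l1 l2 l3 x y : R) (s : nat) :
  commutator (Theta l1 l2 l3 y s) (Theta l1 l2 l3 x s) =
    (2 * (x * y) ^+ s * (x ^+ s - y ^+ s))
    *: ((l3 * (x * y) ^+ s) *: qi l1 l2 l3
        - (l2 * (x ^+ s + y ^+ s)) *: qj l1 l2 l3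
        + l1 *: qk l1 l2 l3).
Proof.
by rewrite /commutator !Theta_coord exprMn; apply: gquatP => /=; ring.
Qed.

Theorem theorem3p3 (R : realType) (l1 l2 l3 alpha beta W0 W1 : R) (s n m : nat)
    (alpha_neq0 : alpha <> 0) (beta_neq0 : beta <> 0)
    (alpha_neq_beta : alpha <> beta)
    (s_ge1 : (1 <= s)%N) (Ws_neq0 : horadam alpha beta W0 W1 s <> 0)
    (le_mn : (m <= n)%N) :
  let A := horadamA beta W0 W1 in
  let B := horadamB alpha W0 W1 in
  let Q := QW l1 l2 l3 alpha beta W0 W1 s in
  let Ta := Theta l1 l2 l3 alpha s in
  let Tb := Theta l1 l2 l3 beta s in
  Q m.+1 * Q n - Q m * Q n.+1 =
    (A * B * (alpha * beta) ^+ (s * m) * (alpha ^+ s - beta ^+ s)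
       / (A * alpha ^+ s - B * beta ^+ s) ^+ 2)
    *: ((alpha ^+ (s * (n - m)) - beta ^+ (s * (n - m))) *: (Ta * Tb)
        + alpha ^+ (s * (n - m)) *: commutator Tb Ta)
  /\
  commutator Tb Ta =
    (2 * (alpha * beta) ^+ s * (alpha ^+ s - beta ^+ s))
    *: ((l3 * (alpha * beta) ^+ s) *: qi l1 l2 l3
        - (l2 * (alpha ^+ s + beta ^+ s)) *: qj l1 l2 l3
        + l1 *: qk l1 l2 l3).
Proof.
move=> A B Q Ta Tb; split; last exact: commutator_Theta.
have := Binet_dOcagne m (n - m)
  (fun k => QW_Binet l1 l2 l3 W0 W1 s k alpha_neq_beta).
(* [subnK] uses [m <= n] to restore [n]; the other rewrites move the square under the inverse and
   merge the powers. *)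
by rewrite subnK // exprVn -exprMn -!exprM.
Qed.
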